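(* Let $d=(d_1,\ldots,d_n)$ be a degree sequence with $n\ge 3$ and $\sum_i d_i>2n$, and let $m=\frac12\sum_i d_i$. There is a core cactus realization of $d$ if and only if $\mu_{odd}\le\mu_1$ and $m\le\left\lfloor\frac{3(n-1)-\mu_1}{2}\right\rfloor$.
   Context: A degree sequence is a sequence of integers $d_i\in\{1,\ldots,n-1\}$ with even sum and $d_1\ge\cdots\ge d_n$; a realization is a simple graph on $\{1,\ldots,n\}$ with $\deg(i)=d_i$. A cactus is a connected simple graph in which every edge lies on at most one cycle; a bridge is an edge whose removal disconnects the graph; a core cactus is a cactus with no bridge whose removal splits the graph into two components each containing a cycle. $\mu_1$ is the number of entries of $d$ equal to $1$, and $\mu_{odd}$ is the number of entries that are odd integers greater than $1$. *)

(* Defs.v *)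
From mathcomp Require Import all_boot.
Set Implicit Arguments. Unset Strict Implicit. Unset Printing Implicit Defensive.

Section Graphs.
Variable T : finType.

Definition simple_graph (e : rel T) : Prop := symmetric e /\ irreflexive e.

Definition deg (e : rel T) (x : T) : nat := #|[set y | e x y]|.

Definition connected_graph (e : rel T) : Prop := forall x y, connect e x y.

Definition is_cycle (e : rel T) (c : seq T) : Prop :=
  [/\ uniq c, 3 <= size c & cycle e c].

Definition cycle_edges (c : seq T) : {set {set T}} :=
  [set [set x; next c x] | x in c].

Definition del_edge (e : rel T) (u v : T) : rel T :=
  fun x y => e x y && ([set x; y] != [set u; v]).

Definition cactus (e : rel T) : Prop :=
  connected_graph e /\
  forall u v, e u v -> forall c1 c2, is_cycle e c1 -> is_cycle e c2 ->
    [set u; v] \in cycle_edges c1 -> [set u; v] \in cycle_edges c2 ->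
    cycle_edges c1 = cycle_edges c2.

Definition bridge (e : rel T) (u v : T) : Prop :=
  e u v /\ ~ connected_graph (del_edge e u v).

Definition comp_has_cycle (e : rel T) (x : T) : Prop :=
  exists c, is_cycle e c /\ all (connect e x) c.

(* Core cactus: cactus with no bridge whose removal leaves two components
   each containing a cycle (the two components being those of u and v). *)
Definition core_cactus (e : rel T) : Prop :=
  cactus e /\
  ~ exists u v, [/\ bridge e u v, comp_has_cycle (del_edge e u v) u
                   & comp_has_cycle (del_edge e u v) v].
End Graphs.

(* Degree sequences on vertices 'I_n (vertex i stands for i+1). *)
Definition degree_sequence (n : nat) (d : 'I_n -> nat) : Prop :=
  [/\ forall i, 1 <= d i <= n.-1,
      ~~ odd (\sum_(i < n) d i)
    & forall i j : 'I_n, i <= j -> d j <= d i].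

Definition realizes (n : nat) (d : 'I_n -> nat) (e : rel 'I_n) : Prop :=
  simple_graph e /\ forall i, deg e i = d i.

Definition mu1 (n : nat) (d : 'I_n -> nat) : nat := #|[set i | d i == 1]|.
Definition muodd (n : nat) (d : 'I_n -> nat) : nat :=
  #|[set i | odd (d i) && (1 < d i)]|.

(* Main.v *)
Require Import Defs.
From mathcomp Require Import all_boot zify.
Set Implicit Arguments. Unset Strict Implicit. Unset Printing Implicit Defensive.

(** Necessity. If cycles are pairwise edge-disjoint, deleting an edge of a cycle
    turns at least three cyclic edges (edges lying on a cycle) into non-cyclic
    ones, so induction down to the acyclic case gives
    [3 m <= 3 (n - 1) + #cyclic edges]; leaf edges are not cyclic, which yields
    the bound on [m].  For [muodd <= mu1], prune leaves one at a time: this never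
    increases [mu1 - muodd], and once no leaf is left, every edge lies on a cycle
    (each side of a bridge would have too many edges to be acyclic), so the edges
    at a vertex are paired up by the cycles through it and all degrees are even.

    Sufficiency. Run the pruning backwards: remove a leaf while lowering by one an
    odd degree [> 1] if there is one, and otherwise a degree [>= 4]. When no leaf
    is left all degrees are even, and the graph is one cycle with triangles glued
    to it successively.

    Graphs live on a fixed vertex type; a vertex of degree [0] stands for an
    absent vertex. *)

(** * Edges of a cycle *)

Lemma set2_inj (T : finType) (a b c d : T) :
  [set a; b] = [set c; d] -> (a = c /\ b = d) \/ (a = d /\ b = c).
Proof.
move=> E; have := set21 a b; rewrite E => /set2P[] ?; subst a.
  have := set22 c b; rewrite E => /set2P[] ?; subst b; last by left.
  by have := set22 c d; rewrite -E => /set2P[] <-; left.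
have := set22 d b; rewrite E => /set2P[] ?; subst b; first by right.
by have := set21 c d; rewrite -E => /set2P[] <-; right.
Qed.

(** The orbit of [x] under [next c] is all of [c], so a property carried along by [next c] spreads
    once around the cycle. *)
Lemma next_ind (T : finType) (c : seq T) (P : pred T) x :
  uniq c -> x \in c -> P x ->
  (forall w, w \in c -> P w -> P (next c w)) -> forall w, w \in c -> P w.
Proof.
move=> Uc xc Px IH w; rewrite -(fconnect_cycle (cycle_next Uc) xc) => cxw.
rewrite -(iter_findex cxw); elim: (findex _ _ _) => //= k IHk.
apply: IH IHk; rewrite -(fconnect_cycle (cycle_next Uc) xc).
exact: fconnect_iter.
Qed.

Lemma next_neq (T : finType) (c : seq T) x :
  uniq c -> 1 < size c -> x \in c -> next c x != x.
Proof.
move=> Uc sc xc; apply/eqP => E.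
have H : {subset c <= [:: x]}.
  move=> w wc; rewrite inE.
  by apply: (next_ind (P := pred1 x) Uc xc) wc => //= y _ /eqP->; rewrite E.
by have := uniq_leq_size Uc H; rewrite leqNgt sc.
Qed.

Lemma next_next_neq (T : finType) (c : seq T) x :
  uniq c -> 2 < size c -> x \in c -> next c (next c x) != x.
Proof.
move=> Uc sc xc; apply/eqP => E.
have H : {subset c <= [:: x; next c x]}.
  apply: (next_ind Uc xc); first by rewrite mem_head.
  by move=> y _; rewrite !inE => /orP[]/eqP->; rewrite ?E eqxx ?orbT.
by have := uniq_leq_size Uc H; rewrite leqNgt sc.
Qed.

Lemma next_neq_prev (T : finType) (c : seq T) x :
  uniq c -> 2 < size c -> x \in c -> next c x != prev c x.
Proof.
move=> Uc sc xc; apply: contra (next_next_neq Uc sc xc) => /eqP->.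
by rewrite next_prev.
Qed.

Lemma mem_cycle_edges (T : finType) (c : seq T) a b : uniq c ->
  ([set a; b] \in cycle_edges c) =
  (a \in c) && ((b == next c a) || (b == prev c a)).
Proof.
move=> Uc; apply/imsetP/andP => [[x xc /set2_inj[[-> ->]|[-> ->]]]|[ac]].
- by rewrite xc eqxx.
- by rewrite mem_next xc prev_next // eqxx orbT.
case/orP=> /eqP->; first by exists a.
by exists (prev c a); rewrite ?mem_prev // next_prev // setUC.
Qed.

Lemma mem_cycle_edges_next (T : finType) (c : seq T) x :
  x \in c -> [set x; next c x] \in cycle_edges c.
Proof. by move=> xc; apply/imsetP; exists x. Qed.

(** A vertex has only two neighbours on a cycle. The two distinct [c1]-neighbours of a vertex of
    [c1] are therefore exactly its [c2]-neighbours, so [c1] is closed under [next c2] and covers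
    [c2]. *)
Lemma cycle_edges_sub_eq (T : finType) (c1 c2 : seq T) :
  uniq c1 -> uniq c2 -> 2 < size c1 -> 2 < size c2 ->
  cycle_edges c1 \subset cycle_edges c2 -> cycle_edges c1 = cycle_edges c2.
Proof.
move=> U1 U2 s1 s2 /subsetP S.
have H x : x \in c1 -> x \in c2 /\
    [|| (next c2 x == next c1 x) | (next c2 x == prev c1 x)].
  move=> xc.
  have := S _ (mem_cycle_edges_next xc); rewrite mem_cycle_edges // => /andP[x2 N].
  have : [set x; prev c1 x] \in cycle_edges c2.
    by apply: S; rewrite mem_cycle_edges // xc eqxx orbT.
  rewrite mem_cycle_edges // => /andP[_ P]; split=> //.
  move: N P (next_neq_prev U1 s1 xc).
  by do 2! case/orP=> /eqP->; rewrite ?eqxx ?orbT.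
have [x xc] : exists x, x \in c1.
  by case: c1 s1 {U1 S H} => // x p _; exists x; rewrite mem_head.
have S21 : forall w, w \in c2 -> w \in c1.
  apply: (next_ind (P := [in c1]) U2 (H x xc).1 xc) => w _ w1 /=.
  by case: (H w w1) => _ /orP[]/eqP->; rewrite ?mem_next ?mem_prev.
apply/eqP; rewrite eqEsubset; apply/andP; split; first exact/subsetP.
apply/subsetP => _ /imsetP[w /S21 w1 ->].
by rewrite mem_cycle_edges // w1; case: (H w w1).
Qed.

(** * Cycles and connectivity *)

Lemma cycle_mono (T : finType) (e e' : rel T) c :
  subrel e e' -> is_cycle e c -> is_cycle e' c.
Proof. by move=> S [? ? /(sub_cycle S)]. Qed.

Lemma connect_mono (T : finType) (e e' : rel T) :
  subrel e e' -> subrel (connect e) (connect e').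
Proof. by move=> S; apply: connect_sub => x y /S/connect1. Qed.

Lemma cycle_edge_rel (T : finType) (e : rel T) c a b :
  symmetric e -> is_cycle e c -> [set a; b] \in cycle_edges c ->
  [/\ e a b, a \in c & b \in c].
Proof.
move=> sy [Uc _ cc]; rewrite mem_cycle_edges // => /andP[ac /orP[]/eqP->].
  by split=> //; rewrite ?mem_next //; apply: next_cycle.
by split=> //; rewrite ?mem_prev // sy; apply: prev_cycle.
Qed.

(** The long way round from [b] to [a] uses every edge of [c] but this one. *)
Lemma connect_cycle_edge (T : finType) (r : rel T) c a b :
  symmetric r -> uniq c -> 2 < size c -> [set a; b] \in cycle_edges c ->
  (forall x, x \in c -> [set x; next c x] != [set a; b] -> r x (next c x)) ->
  connect r a b.
Proof.
move=> sr Uc sc.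
wlog -> : a b / b = next c a => [IH abc|].
  move: (abc); rewrite mem_cycle_edges // => /andP[ac /orP[]/eqP E H].
    exact: IH.
  rewrite (sym_connect_sym sr); apply: IH; first by rewrite E next_prev.
    by rewrite setUC.
  by move=> x; rewrite (setUC [set b]); apply: H.
rewrite mem_cycle_edges // => /andP[ac _] H.
rewrite (sym_connect_sym sr).
(* If the walk from [next c a] along [c] never reached [a], it would never meet the missing edge at
   [a]; meeting it at [next c a] would need a cycle of length two. So the walk would cover all of
   [c], including [a]. *)
apply: contraT => nc.
suff /(_ a ac) /= : forall w, w \in c -> connect r (next c a) w by rewrite (negPf nc).
apply: (@next_ind _ _ _ (next c a)); rewrite ?mem_next ?connect0 //.
move=> w wc cw; apply: (connect_trans cw (connect1 _)).
apply: H => //; apply/eqP => /set2_inj[[E _]|[E1 E2]].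
  by move: nc; rewrite -{2}E cw.
by have := next_next_neq Uc sc ac; rewrite -{1}E1 E2 eqxx.
Qed.

(** A simple [r]-path from [b] to [a] is closed up by the edge [ab]; the third clause records that
    this is the only edge taken from outside [r]. *)
Lemma cycle_of_connect (T : finType) (e r : rel T) a b :
  subrel r e -> e a b -> ~~ r a b -> ~~ r b a -> a != b -> connect r b a ->
  exists c, [/\ is_cycle e c, [set a; b] \in cycle_edges c
    & forall x y, [set x; y] \in cycle_edges c ->
        [\/ [set x; y] = [set a; b], r x y | r y x]].
Proof.
move=> sre eab nrab nrba nab /connectP[p0 pp0 Ea].
case/shortenP: pp0 Ea => p pp Up _ Ea.
pose r' x y := r x y || (x == a) && (y == b).
have cyc : cycle r' (b :: p).
  rewrite /= rcons_path -Ea; apply/andP; split; last by rewrite /r' !eqxx orbT.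
  by apply: sub_path pp => x y; rewrite /r' => ->.
(* [a] is the last entry, so its index falls off the end of [p] and [nth] returns its default
   [b]. *)
have nxt : next (b :: p) a = b.
  by rewrite next_nth {1}Ea mem_last Ea index_last // nth_default.
have ap : a \in b :: p by rewrite Ea mem_last.
exists (b :: p); split.
- split=> //; last first.
    by apply: sub_cycle cyc => x y /orP[/sre//|/andP[/eqP-> /eqP->]].
  (* An empty [p] would give [a = b], and a single entry would give the excluded arc [r b a]. *)
  move: pp nrba nab; rewrite Ea; case: p {Up Ea cyc nxt ap} => [|x [|]] //=.
    by rewrite eqxx.
  by rewrite andbT => ->.
- by rewrite -{1}nxt mem_cycle_edges_next.
move=> x y /imsetP[z zc /set2_inj E].
have {E} : [set x; y] = [set z; next (b :: p) z] /\
   ((x = z /\ y = next (b :: p) z) \/ (y = z /\ x = next (b :: p) z)).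
  by case: E => -[-> ->]; split; auto; rewrite setUC.
case=> -> E; case/orP: (next_cycle cyc zc) => [rz|/andP[/eqP-> /eqP->]].
  by case: E => -[-> ->]; [constructor 2 | constructor 3].
by constructor 1.
Qed.

(** * Cycles forced by degrees *)

(** A simple path in [S] is prolonged at its head by a neighbour other than the second vertex:
    either this neighbour is new, or it lies on the path and closes a cycle. A simple path cannot
    outgrow [#|T|] vertices. *)
Lemma cycle_of_min_degree2 (T : finType) (e : rel T) (S : {set T}) x0 :
  symmetric e -> irreflexive e -> x0 \in S ->
  (forall x, x \in S -> 1 < #|[set y in S | e x y]|) ->
  exists c, is_cycle e c /\ {subset c <= S}.
Proof.
move=> sy ir x0S H.
have P k : (exists c, is_cycle e c /\ {subset c <= S}) \/
    exists x p, [/\ uniq (x :: p), path e x p, {subset x :: p <= S} & size p = k].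
  elim: k => [|k [IH|[x [p [U pp pS sp]]]]]; [right|by left|].
    by exists x0, [::]; split=> // y; rewrite inE => /eqP->.
  have xS : x \in S by apply: pS; rewrite mem_head.
  have [z [zS xz nz]] : exists z, [/\ z \in S, e x z & z != head x p].
    have /card_gt1P[y [z [/setIdP[yS xy] /setIdP[zS xz] nyz]]] := H x xS.
    have [E|] := eqVneq y (head x p); last by exists y.
    by exists z; split=> //; rewrite eq_sym -E.
  have [zp|zp] := boolP (z \in x :: p); last first.
    right; exists z, (x :: p); split; last by rewrite /= sp.
    - by rewrite cons_uniq zp U.
    - by rewrite /= sy xz.
    by move=> y; rewrite inE => /orP[/eqP->|/pS].
  left; move: zp; rewrite inE => /orP[/eqP Ez|zp]; first by rewrite Ez ir in xz.
  case/splitPr: zp U pp pS nz sp => p1 p2 U pp pS nz sp.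
  move: U pp; rewrite -cat_rcons -cat_cons cat_uniq cat_path => /andP[U _] /andP[pp _].
  exists (x :: rcons p1 z); split.
    split=> //.
      by rewrite /= size_rcons; case: p1 nz {U pp pS sp} => //=; rewrite eqxx.
    by rewrite /cycle rcons_path pp last_rcons sy.
  by move=> y yc; apply: pS; rewrite -cat_rcons -cat_cons mem_cat yc.
case: (P #|T|) => // -[x [p [U _ _ sp]]].
by have := max_card [in x :: p]; rewrite (card_uniqP U) /= sp ltnn.
Qed.

(** Deleting a vertex with at most one neighbour in [S] lowers the degree sum by at most 2, which
    preserves the hypothesis; without such a vertex the minimum degree is 2. The slack [.+1] serves
    one side of a deleted bridge, where one vertex may be left with degree 1. *)
Lemma cycle_of_degree_sum (T : finType) (e : rel T) (S : {set T}) :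
  symmetric e -> irreflexive e -> S != set0 ->
  2 * #|S| <= (\sum_(x in S) #|[set y in S | e x y]|).+1 ->
  exists c, is_cycle e c /\ {subset c <= S}.
Proof.
move=> sy ir; elim: {S}_.+1 {-2}S (ltnSn #|S|) => // k IH S.
rewrite ltnS => Sk /set0Pn[x0 x0S] Ssum.
have [/exists_inP[x xS dx]|] :=
  boolP [exists x in S, #|[set y in S | e x y]| <= 1]; last first.
  rewrite negb_exists_in => /forall_inP H.
  by apply: cycle_of_min_degree2 x0S _ => // x /H; rewrite -ltnNge.
have cS : #|S| = #|S :\ x|.+1 by rewrite (cardsD1 x) xS.
have sumE : \sum_(z in S) #|[set y in S | e z y]| =
    #|[set y in S | e x y]| + #|[set y in S | e x y]| +
    \sum_(z in S :\ x) #|[set y in S :\ x | e z y]|.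
  rewrite (big_setD1 x) //= -addnA; congr (_ + _).
  have -> : #|[set y in S | e x y]| = \sum_(z in S :\ x) (e x z : nat).
    rewrite -sum1_card (big_setID (S :\ x)) /= [X in _ + X]big1 ?addn0.
      rewrite [RHS]big_mkcond [LHS]big_mkcond; apply: eq_bigr => z _.
      by rewrite !inE; case: (z == x); case: (z \in S); case: (e x z).
    move=> z; rewrite !inE; case: eqP => [->|_]; rewrite ?ir ?andbF //.
    by case: (z \in S).
  rewrite -big_split; apply: eq_bigr => z /setD1P[zx zS] /=.
  rewrite (cardsD1 x) inE xS sy /=; congr (_ + _); apply: eq_card => y.
  by rewrite !inE andbA.
(* This rules out that [x] is alone in [S]: the degree sum would then be 0, while the hypothesis
   demands at least 1. *)
have dx0 : S :\ x = set0 -> #|[set y in S | e x y]| = 0.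
  move=> E; apply/eqP; rewrite cards_eq0 -subset0; apply/subsetP => y /setIdP[yS xy].
  by rewrite -E !inE yS andbT; apply: contraTneq xy => ->; rewrite ir.
have [c [cc cs]] : exists c, is_cycle e c /\ {subset c <= S :\ x}.
  apply: IH; first lia; last lia.
  apply/eqP => E; have := dx0 E; rewrite E cards0 in cS.
  by move=> d0; rewrite sumE d0 E big_set0 cS in Ssum.
by exists c; split=> // y /cs /setD1P[].
Qed.

(** * Graphs with edge-disjoint cycles *)

Definition edge_disjoint_cycles (T : finType) (e : rel T) : Prop :=
  forall c1 c2 g, is_cycle e c1 -> is_cycle e c2 ->
    g \in cycle_edges c1 -> g \in cycle_edges c2 ->
    cycle_edges c1 = cycle_edges c2.

Lemma edge_disjoint_cycles_mono (T : finType) (e e' : rel T) :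
  subrel e e' -> edge_disjoint_cycles e' -> edge_disjoint_cycles e.
Proof. by move=> S H c1 c2 g /(cycle_mono S) ? /(cycle_mono S) ?; apply: H. Qed.

Lemma del_edge_sub (T : finType) (e : rel T) u v : subrel (del_edge e u v) e.
Proof. by move=> x y /andP[]. Qed.

Lemma del_edge_sym (T : finType) (e : rel T) u v :
  symmetric e -> symmetric (del_edge e u v).
Proof. by move=> sy x y; rewrite /del_edge sy setUC. Qed.

Lemma del_edge_irr (T : finType) (e : rel T) u v :
  irreflexive e -> irreflexive (del_edge e u v).
Proof. by move=> ir x; rewrite /del_edge ir. Qed.

Lemma del_edgeC (T : finType) (e : rel T) u v : del_edge e u v =2 del_edge e v u.
Proof. by move=> x y; rewrite /del_edge (setUC [set u]). Qed.

Lemma del_edge_mono (T : finType) (e e' : rel T) u v :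
  subrel e e' -> subrel (del_edge e u v) (del_edge e' u v).
Proof. by move=> S x y /andP[/S exy n]; apply/andP. Qed.

Lemma del_edge_same (T : finType) (e : rel T) u v : del_edge e u v u v = false.
Proof. by rewrite /del_edge eqxx andbF. Qed.

(** An [r]-path joining [a] and [b] would close up with [ab] to a cycle sharing [ab] with [c], hence
    with the same edges as [c]. It would then contain [uv], which [r] lacks. *)
Lemma cycle_edges_separate (T : finType) (e r : rel T) c a b u v :
  symmetric e -> irreflexive e -> edge_disjoint_cycles e -> is_cycle e c ->
  [set a; b] \in cycle_edges c -> [set u; v] \in cycle_edges c ->
  [set a; b] != [set u; v] ->
  symmetric r -> subrel r e -> ~~ r a b -> ~~ r u v -> ~~ connect r a b.
Proof.
move=> sy ir K cc gc hc ngh sr re nab nuv; apply/negP.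
rewrite (sym_connect_sym sr) => cab.
have [eab _ _] := cycle_edge_rel sy cc gc.
have ab : a != b by apply: contraTneq eab => ->; rewrite ir.
have [|c' [cc' gc' H]] := cycle_of_connect re eab nab _ ab cab.
  by rewrite sr.
have := hc; rewrite (K _ _ _ cc cc' gc gc') => /H[E||].
- by rewrite E eqxx in ngh.
- by rewrite (negPf nuv).
- by rewrite sr (negPf nuv).
Qed.

(** * Counting the edges that lie on cycles *)

Definition arcs (T : finType) (e : rel T) : {set T * T} := [set p | e p.1 p.2].

(** Lying on a cycle is encoded by the decidable test that the edge is not a bridge. Every edge is
    counted twice, once per direction, as in a degree sum. *)
Definition cyclic_arcs (T : finType) (e : rel T) : {set T * T} :=
  [set p in arcs e | connect (del_edge e p.1 p.2) p.1 p.2].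

Lemma sum_deg (T : finType) (e : rel T) : \sum_x deg e x = #|arcs e|.
Proof.
rewrite -sum1_card /arcs; under [RHS]eq_bigl do rewrite inE.
rewrite -(pair_big_dep xpredT e (fun _ _ => 1)) /=.
by apply: eq_bigr => x _; rewrite /deg -sum1_card; apply: eq_bigl => y; rewrite inE.
Qed.

Lemma cyclic_arcs_cycle (T : finType) (e : rel T) a b :
  symmetric e -> irreflexive e -> (a, b) \in cyclic_arcs e ->
  exists c, is_cycle e c /\ [set a; b] \in cycle_edges c.
Proof.
move=> sy ir; rewrite !inE /= => /andP[eab cab].
have sd := del_edge_sym a b sy.
have nab := negbT (del_edge_same e a b).
have ab : a != b by apply: contraTneq eab => ->; rewrite ir.
rewrite (sym_connect_sym sd) in cab.
have [|c [cc abc _]] := cycle_of_connect (@del_edge_sub _ e a b) eab nab _ ab cab.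
  by rewrite sd.
by exists c.
Qed.

Lemma cycle_cyclic_arcs (T : finType) (e : rel T) c a b :
  symmetric e -> is_cycle e c -> [set a; b] \in cycle_edges c ->
  (a, b) \in cyclic_arcs e.
Proof.
move=> sy cc abc; have [eab _ _] := cycle_edge_rel sy cc abc.
case: cc => Uc sc cc.
rewrite !inE eab /=; apply: connect_cycle_edge abc _ => //.
  exact: del_edge_sym.
by move=> x xc n; rewrite /del_edge n andbT; apply: next_cycle.
Qed.

Lemma acyclic_sum_deg (T : finType) (e : rel T) :
  symmetric e -> irreflexive e -> 0 < #|T| -> cyclic_arcs e = set0 ->
  \sum_x deg e x + 2 <= 2 * #|T|.
Proof.
move=> sy ir T0 NB; rewrite leqNgt; apply/negP => lt.
have [||c [cc _]] := @cycle_of_degree_sum T e setT sy ir.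
- by rewrite -card_gt0 cardsT.
- rewrite cardsT; have -> : \sum_(x in setT) #|[set y in setT | e x y]| = \sum_x deg e x.
    apply: eq_big => x; rewrite ?inE // => _.
    by apply: eq_card => y; rewrite !inE.
  lia.
have [Uc sc _] := cc; case: c sc cc Uc => // x p _ cc Uc.
have := cycle_cyclic_arcs sy cc (mem_cycle_edges_next (mem_head x p)).
by rewrite NB inE.
Qed.

(** With edges counted twice, deleting an edge of a cycle [c] lowers the left side by 6 and removes
    at least [2 * size c >= 6] cyclic arcs; the induction ends at the acyclic bound. *)
Lemma edge_disjoint_cycles_sum_deg (T : finType) (e : rel T) :
  symmetric e -> irreflexive e -> 0 < #|T| -> edge_disjoint_cycles e ->
  3 * \sum_x deg e x + 6 <= 6 * #|T| + #|cyclic_arcs e|.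
Proof.
move=> sy ir T0; elim: {e}_.+1 {-2}e (ltnSn #|arcs e|) sy ir => // k IH e.
rewrite ltnS => ek sy ir K.
have [NB|/set0Pn[[a b] abN]] := eqVneq (cyclic_arcs e) set0.
  have := acyclic_sum_deg sy ir T0 NB; lia.
have [c [cc abc]] := cyclic_arcs_cycle sy ir abN.
have [eab _ _] := cycle_edge_rel sy cc abc.
have [Uc sc cyc] := cc.
have sd := del_edge_sym a b sy.
have ab : a != b by apply: contraTneq eab => ->; rewrite ir.
have E : #|arcs e| = 2 + #|arcs (del_edge e a b)|.
  rewrite (cardsD1 (a, b)) inE eab (cardsD1 (b, a)) !inE /= sy eab.
  rewrite xpair_eqE eq_sym (negPf ab) /= addnA; congr (_ + _).
  apply: eq_card => -[x y]; rewrite !inE /del_edge /= !xpair_eqE.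
  rewrite andbA andbC; congr (_ && _); rewrite -negb_or; congr (~~ _).
  apply/idP/eqP => [/orP[]/andP[/eqP-> /eqP->] //|/set2_inj[[-> ->]|[-> ->]]].
  - by rewrite setUC.
  - by rewrite !eqxx orbT.
  - by rewrite !eqxx.
(* [A] and [B] are the two orientations of [c], disjoint because [c] is longer than two. *)
pose A := [set (x, next c x) | x in c]; pose B := [set (next c x, x) | x in c].
have cA : #|A| = size c.
  by rewrite card_imset ?(card_uniqP Uc) // => x y [].
have cB : #|B| = size c.
  by rewrite card_imset ?(card_uniqP Uc) // => x y [].
have dAB : A :&: B = set0.
  apply/setP => p; rewrite !inE; apply/andP => -[/imsetP[x xc ->] /imsetP[y yc [E1 E2]]].
  by have := next_next_neq Uc sc yc; rewrite -E1 E2 eqxx.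
have sAB : A :|: B \subset cyclic_arcs e.
  apply/subsetP => p /setUP[]/imsetP[x xc ->]; apply: cycle_cyclic_arcs cc _ => //.
    exact: mem_cycle_edges_next.
  by rewrite setUC mem_cycle_edges_next.
(* Once [ab] is gone, every other edge of [c] separates its ends when deleted, so no arc of [c]
   stays cyclic. *)
have sN : cyclic_arcs (del_edge e a b) \subset cyclic_arcs e :\: (A :|: B).
  apply/subsetP => -[x y]; rewrite !inE /= => /andP[xy cxy].
  have exy := del_edge_sub xy.
  have -> /= : e x y && connect (del_edge e x y) x y.
    rewrite exy; apply: connect_mono cxy; exact/del_edge_mono/del_edge_sub.
  rewrite andbT; apply/negP => H.
  have gc : [set x; y] \in cycle_edges c.
    case/orP: H => /imsetP[z zc [-> ->]]; last rewrite setUC;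
    exact: mem_cycle_edges_next.
  have := @cycle_edges_separate T e (del_edge (del_edge e a b) x y) c x y a b
    sy ir K cc gc abc.
  rewrite cxy; have [_ -> ] := andP xy => /(_ isT) F.
  suff: ~~ true by [].
  apply: F.
  - exact: del_edge_sym.
  - by move=> ? ? /del_edge_sub/del_edge_sub.
  - by rewrite del_edge_same.
  - by rewrite /del_edge eqxx andbF.
have := subset_leq_card sN; have := subset_leq_card sAB.
rewrite cardsD (setIidPr sAB) cardsU dAB cards0 cA cB => h1 h2.
have := IH (del_edge e a b); rewrite -!sum_deg in E ek *.
have lt : \sum_x deg (del_edge e a b) x < k by lia.
move=> /(_ lt sd (del_edge_irr _ _ ir)).
move=> /(_ (edge_disjoint_cycles_mono (@del_edge_sub _ _ _ _) K)). move: h1 h2 E sc.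
move: (\sum_x deg e x) (\sum_x _) #|cyclic_arcs e| #|cyclic_arcs _| => ? ? ? ?; lia.
Qed.

(** * Even degrees *)

Lemma cycle_connect_off (T : finType) (e : rel T) c x : is_cycle e c -> x \in c ->
  forall w, w \in c -> w != x ->
  connect [rel y z | [&& e y z, y != x & z != x]] (next c x) w.
Proof.
move=> [Uc sc cc] xc w wc; apply/implyP.
(* The induction starts at [x], where the implication is vacuous; the step out of [x] lands on
   [next c x], joined to itself by the empty path. *)
apply: (@next_ind T c (fun w => (w != x) ==>
  connect [rel y z | [&& e y z, y != x & z != x]] (next c x) w) x) wc => //.
  by rewrite eqxx.
move=> {}w wc; have [->|wx] := eqVneq w x; first by rewrite connect0 implybT.
move=> /= cw; apply/implyP => nx; apply: (connect_trans cw); apply: connect1 => /=.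
by rewrite wx nx (next_cycle cc).
Qed.

(* The neighbours of x split into pairs: those joined by a path avoiding x. *)
Lemma even_deg_cyclic (T : finType) (e : rel T) x :
  symmetric e -> irreflexive e -> edge_disjoint_cycles e ->
  (forall y, e x y -> (x, y) \in cyclic_arcs e) -> ~~ odd (deg e x).
Proof.
move=> sy ir K H.
pose r := [rel y z | [&& e y z, y != x & z != x]].
have sr : symmetric r by move=> y z /=; rewrite sy [(y != x) && _]andbC.
have rc := sym_connect_sym sr.
rewrite /deg (@card_uniform_partition _ 2 (equivalence_partition (connect r) [set y | e x y])).
- by rewrite muln2 odd_double.
- move=> A /imsetP[y]; rewrite inE => xy ->.
  have [c [cc yc]] := cyclic_arcs_cycle sy ir (H y xy).
  have [Uc sc cyc] := cc; have [_ xc _] := cycle_edge_rel sy cc yc.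
  have nx : next c x != x by apply: next_neq => //; lia.
  have px : prev c x != x.
    by apply: contra nx => /eqP {1}<-; rewrite next_prev.
  have np := next_neq_prev Uc sc xc.
  have off := cycle_connect_off cc xc.
  (* [z] is the other neighbour of [x] on the cycle through [xy]; the rest of that cycle joins it to
     [y] off [x]. *)
  have [z [zy zc cyz]] : exists z, [/\ z != y, [set x; z] \in cycle_edges c & connect r y z].
    move: yc; rewrite mem_cycle_edges // xc => /orP[]/eqP->.
      exists (prev c x); rewrite eq_sym np mem_cycle_edges // xc eqxx orbT; split=> //.
      by apply: off; rewrite ?mem_prev.
    exists (next c x); rewrite np mem_cycle_edges // xc eqxx; split=> //.
    by rewrite rc; apply: off; rewrite ?mem_prev.
  have [xz _ _] := cycle_edge_rel sy cc zc.
  suff -> : [set w in [set w | e x w] | connect r y w] = [set y; z].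
    by rewrite cards2 eq_sym zy.
  apply/setP => w; rewrite !inE; apply/andP/orP => [[xw cyw]|[]/eqP->] //.
  (* A third neighbour [w] in the class would give a path from [x] through [w] to [y] that uses
     neither [xy] nor [xz], two edges of [c]. *)
  apply/orP; apply: contraT; rewrite negb_or => /andP[wy wz].
  pose s := del_edge (del_edge e x y) x z.
  have ss : symmetric s by do 2!apply: del_edge_sym.
  have := @cycle_edges_separate T e s c x y x z sy ir K cc yc zc.
  have -> : [set x; y] != [set x; z].
    by apply: contraNneq zy => /set2_inj[[_ ->]|[-> ->]].
  move=> /(_ isT ss) F; suff /negP[] : ~~ connect s x y.
    apply: (@connect_trans _ _ w).
      apply: connect1; rewrite /s /del_edge xw /=; apply/andP.
      split; [apply: contraNneq wy|apply: contraNneq wz]; case/set2_inj=> [[_ ->]|[E F']] //;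
      by move: xw; rewrite F' ir.
    rewrite rc in cyw; apply: connect_mono cyw => p q /= /and3P[pq px' qx].
    rewrite /s /del_edge pq /=; apply/andP.
    by split; apply/eqP => /set2_inj[[E _]|[_ E]]; rewrite E eqxx in px' qx.
  apply: F; rewrite /s.
  - by move=> p q /del_edge_sub/del_edge_sub.
  - by rewrite /del_edge eqxx !andbF.
  - by rewrite del_edge_same.
apply: equivalence_partitionP => p q t _ _ _; split; first exact: connect0.
by move=> cpq; apply: same_connect.
Qed.

(** * Leaves and odd degrees *)

(** Sending [x] to [v], its only possible neighbour, and fixing all other vertices maps each step of
    an [r]-path to a step of [r'] or to a single vertex. *)
Lemma connect_retract_leaf (T : finType) (r r' : rel T) x v a b :
  symmetric r -> (forall z, r x z -> z = v) ->
  (forall z w, z != x -> w != x -> r z w -> r' z w) ->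
  a != x -> b != x -> connect r a b -> connect r' a b.
Proof.
move=> sr rx rr' ax bx /connectP[p pp E].
pose f z := if z == x then v else z.
have -> : a = f a by rewrite /f (negPf ax).
have -> : b = f b by rewrite /f (negPf bx).
rewrite {}E {b bx ax}; elim: p a pp => [|z p IH] a /=; first by rewrite connect0.
case/andP=> az /IH; apply: connect_trans; rewrite {IH}/f.
have [Ea|ax] := eqVneq a x.
  by rewrite Ea in az; rewrite (rx _ az) if_same connect0.
have [Ez|zx] := eqVneq z x; last by apply/connect1/rr'.
by rewrite Ez sr in az; rewrite (rx _ az) connect0.
Qed.

Lemma comp_has_cycle_mono (T : finType) (e e' : rel T) x :
  subrel e e' -> comp_has_cycle e x -> comp_has_cycle e' x.
Proof.
move=> S [c [cc /allP ca]]; exists c; split; first exact: cycle_mono cc.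
by apply/allP => y /ca; apply: connect_mono.
Qed.

(** The core condition with a bridge expressed through its two ends instead of connectedness of the
    whole graph, so that it stays meaningful when pruned vertices become isolated. *)
Definition core_bridgeless (T : finType) (e : rel T) : Prop :=
  forall u v, e u v -> ~~ connect (del_edge e u v) u v ->
    comp_has_cycle (del_edge e u v) u -> ~ comp_has_cycle (del_edge e u v) v.

Lemma deg1P (T : finType) (e : rel T) x : deg e x = 1 ->
  exists2 v, e x v & forall z, e x z -> z = v.
Proof.
move=> /eqP/cards1P[v E]; exists v; first by have := set11 v; rewrite -E inE.
by move=> z xz; apply/set1P; rewrite -E inE.
Qed.

Lemma deg_gt0P (T : finType) (e : rel T) x :
  reflect (exists y, e x y) (0 < deg e x).
Proof.
by apply: (iffP card_gt0P) => -[y]; rewrite ?inE => xy; exists y; rewrite ?inE.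
Qed.

Lemma deg_del_edgel (T : finType) (e : rel T) x v :
  e x v -> deg e x = (deg (del_edge e x v) x).+1.
Proof.
move=> xv; rewrite /deg (cardsD1 v) inE xv; congr (_.+1); apply: eq_card => y.
rewrite !inE /del_edge andbC; congr (_ && ~~ _).
by apply/eqP/eqP => [->|/set2_inj[[_ ->]|[-> ->]]].
Qed.

Lemma deg_del_edge_neq (T : finType) (e : rel T) x v z :
  z != x -> z != v -> deg (del_edge e x v) z = deg e z.
Proof.
move=> zx zv; apply: eq_card => y; rewrite !inE /del_edge.
case: eqP => [/set2_inj[[E _]|[E _]]|]; rewrite ?andbT //.
  by rewrite E eqxx in zx.
by rewrite E eqxx in zv.
Qed.

(** Bookkeeping for a leaf [x] and its neighbour [v]; the additive form avoids truncated
    subtraction. *)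
Lemma sum_update2 (T : finType) (d d' : T -> nat) (F : nat -> nat) x v :
  x != v -> (forall z, z != x -> z != v -> d' z = d z) ->
  \sum_i F (d i) + (F (d' x) + F (d' v)) = \sum_i F (d' i) + (F (d x) + F (d v)).
Proof.
move=> xv H; rewrite (bigD1 x) //= (bigD1 v) 1?eq_sym //=.
rewrite [X in _ = X + _](bigD1 x) //= [X in _ = _ + X + _](bigD1 v) 1?eq_sym //=.
have -> : \sum_(i | (i != x) && (i != v)) F (d' i) = \sum_(i | (i != x) && (i != v)) F (d i).
  by apply: eq_bigr => z /andP[? ?]; rewrite H.
lia.
Qed.

Lemma card_set_sum (T : finType) (P : pred T) : #|[set i | P i]| = \sum_i (P i : nat).
Proof.
by rewrite -sum1_card big_mkcond; apply: eq_bigr => i _; rewrite inE; case: (P i).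
Qed.

Lemma card_update2 (T : finType) (d d' : T -> nat) (P : pred nat) x v :
  x != v -> (forall z, z != x -> z != v -> d' z = d z) ->
  #|[set i | P (d i)]| + (P (d' x) + P (d' v)) =
  #|[set i | P (d' i)]| + (P (d x) + P (d v)).
Proof. by move=> xv H; rewrite !card_set_sum (sum_update2 (fun k => P k) xv H). Qed.

(** If [uv] were a bridge, then after its deletion each side would have its end of degree at least 1
    and all other degrees at least 2. The degree sum is then at least twice the size minus 1, so
    both sides contain cycles. *)
Lemma cyclic_arcs_min_degree2 (T : finType) (e : rel T) u v :
  symmetric e -> irreflexive e -> core_bridgeless e ->
  (forall x, deg e x != 1) -> e u v -> (u, v) \in cyclic_arcs e.
Proof.
move=> sy ir N d1 uv; rewrite !inE uv /=; apply: contraT => nc.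
have side a b : e a b -> ~~ connect (del_edge e a b) a b ->
    comp_has_cycle (del_edge e a b) a.
  move=> ab ncab; pose e' := del_edge e a b.
  have sd : symmetric e' by apply: del_edge_sym.
  have id : irreflexive e' by apply: del_edge_irr.
  pose S := [set z | connect e' a z].
  have aS : a \in S by rewrite inE connect0.
  have degS z : z \in S -> #|[set y in S | e' z y]| = deg e' z.
    rewrite inE => az; apply: eq_card => y; rewrite !inE.
    by case: (boolP (e' z y)) => zy; rewrite ?andbF // (connect_trans az (connect1 zy)).
  have da : 0 < deg e' a by have := d1 a; rewrite (deg_del_edgel ab) -/e'; lia.
  have dz z : z \in S -> z != a -> 1 < deg e z.
    move=> zS za; suff /deg_gt0P : exists y, e z y by have := d1 z; lia.
    move: zS; rewrite inE (sym_connect_sym sd) => /connectP[[|y p] /=].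
      by move=> _ E; rewrite E eqxx in za.
    by case/andP=> /del_edge_sub; exists y.
  have [||c [cc cS]] := @cycle_of_degree_sum T e' S sd id.
  - by apply/set0Pn; exists a.
  - rewrite (eq_bigr _ degS) (big_setD1 a) //= (cardsD1 a) aS.
    suff : 2 * #|S :\ a| <= \sum_(i in S :\ a) deg e' i by lia.
    rewrite mulnC -sum_nat_const; apply: leq_sum => z /setD1P[za zS].
    rewrite deg_del_edge_neq ?dz //.
    by apply: contraNneq ncab => E; move: zS; rewrite inE E.
  by exists c; split=> //; apply/allP => y /cS; rewrite inE.
have cv : comp_has_cycle (del_edge e u v) v.
  apply: (@comp_has_cycle_mono _ (del_edge e v u)).
    by move=> x y; rewrite del_edgeC.
  apply: side; rewrite 1?sy // (sym_connect_sym (del_edge_sym _ _ sy)).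
  by rewrite (eq_connect (@del_edgeC _ _ _ _)).
by case: (N u v uv nc (side u v uv nc) cv).
Qed.

(** Paths through the leaf retract to paths avoiding it, so a bridge of the pruned graph was a
    bridge before; cycles on its sides survive putting the leaf back. *)
Lemma core_bridgeless_del_leaf (T : finType) (e : rel T) x v :
  symmetric e -> irreflexive e -> (forall z, e x z -> z = v) ->
  core_bridgeless e -> core_bridgeless (del_edge e x v).
Proof.
move=> sy ir xv N a b ab nab ca cb.
have xiso z : del_edge e x v x z = false.
  by apply/negP => xz; have := xz; rewrite (xv z (del_edge_sub xz)) del_edge_same.
have ax : a != x by apply: contraTneq ab => ->; rewrite xiso.
have bx : b != x by apply: contraTneq ab => ->; rewrite (del_edge_sym _ _ sy) xiso.
have S : subrel (del_edge (del_edge e x v) a b) (del_edge e a b).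
  exact/del_edge_mono/del_edge_sub.
apply: (N a b (del_edge_sub ab)); try exact: comp_has_cycle_mono S _.
apply: contra nab; apply: (@connect_retract_leaf _ _ _ x v) => //.
- exact: del_edge_sym.
- by move=> z /del_edge_sub /xv.
move=> z w zx wx /andP[zw n]; rewrite /del_edge zw n andbT /=.
by apply/eqP => /set2_inj[[E _]|[_ E]]; rewrite E eqxx in zx wx.
Qed.

Lemma card_odd_deg_le_leaves (T : finType) (e : rel T) :
  symmetric e -> irreflexive e -> edge_disjoint_cycles e -> core_bridgeless e ->
  #|[set x | odd (deg e x) && (1 < deg e x)]| <= #|[set x | deg e x == 1]|.
Proof.
elim: {e}_.+1 {-2}e (ltnSn (\sum_x deg e x)) => // k IH e.
rewrite ltnS => ek sy ir K N.
have [/existsP[x /eqP dx]|] := boolP [exists x, deg e x == 1]; last first.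
  rewrite negb_exists => /forallP d1.
  suff -> : [set x | odd (deg e x) && (1 < deg e x)] = set0 by rewrite cards0.
  apply/setP => x; rewrite !inE; apply/negP => /andP[+ _]; apply/negP.
  by apply: even_deg_cyclic => // y; apply: cyclic_arcs_min_degree2.
have [v xv xu] := deg1P dx.
have nxv : x != v by apply: contraTneq xv => ->; rewrite ir.
pose e' := del_edge e x v.
have H z : z != x -> z != v -> deg e' z = deg e z by apply: deg_del_edge_neq.
have dx' : deg e' x = 0 by have := deg_del_edgel xv; rewrite dx => -[].
have dv' : deg e v = (deg e' v).+1.
  rewrite (@deg_del_edgel _ _ v x) 1?sy //; congr _.+1.
  by apply: eq_card => z; rewrite !inE del_edgeC.
have h1 := card_update2 (fun k => odd k && (1 < k)) nxv H.
have h2 := card_update2 (fun k => k == 1) nxv H.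
have h3 := sum_update2 id nxv H.
have h4 : \sum_x deg e' x < k by move: h3 ek; rewrite /= dx dx' dv'; lia.
have := IH e' h4 (del_edge_sym _ _ sy) (del_edge_irr _ _ ir)
  (edge_disjoint_cycles_mono (@del_edge_sub _ _ _ _) K)
  (core_bridgeless_del_leaf sy ir xu N).
move: h1 h2; rewrite /= dx dx' dv'.
move: #|_| #|_| #|_| #|_| => p q s t.
(* New degree 0: two leaves vanish. New degree 1: [v] replaces [x] as a leaf. Otherwise one leaf is
   lost and the parity at [v] flips, changing the odd count by one. *)
case: (deg e' v) => [|[|i]] /=; lia.
Qed.

(** Deleting its edge isolates a leaf, so neither arc of that edge is cyclic. *)
Lemma leaves_cyclic_arcs (T : finType) (e : rel T) :
  symmetric e -> irreflexive e -> connected_graph e -> 2 < #|T| ->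
  #|cyclic_arcs e| + 2 * #|[set x | deg e x == 1]| <= \sum_x deg e x.
Proof.
move=> sy ir C T3; set L := [set x | deg e x == 1].
pose nb x := odflt x [pick y | e x y].
have nbP x : x \in L -> e x (nb x) /\ forall z, e x z -> z = nb x.
  rewrite inE => /eqP/deg1P[v xv xu]; rewrite /nb; case: pickP => [y /xu->|] //=.
  by move/(_ v); rewrite xv.
pose A := [set (x, nb x) | x in L]; pose B := [set (nb x, x) | x in L].
have cA : #|A| = #|L| by rewrite card_imset // => x y [].
have cB : #|B| = #|L| by rewrite card_imset // => x y [].
(* Two adjacent leaves would form a whole component, hence all of [T], which has more than two
   vertices. *)
have dAB : A :&: B = set0.
  apply/setP => p; rewrite !inE; apply/andP => -[/imsetP[x xL ->] /imsetP[y yL [E1 E2]]].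
  have [xy xu] := nbP x xL; have [_ yu] := nbP y yL.
  suff H : [set: T] \subset [set x; y].
    by have := subset_leq_card H; rewrite cardsT cards2; case: (x == y); lia.
  apply/subsetP => z _; have := C x z.
  have cl : closed e [set x; y].
    apply: intro_closed; first exact: sym_connect_sym.
    move=> p' q pq /set2P[E|E]; rewrite E in pq; rewrite !inE.
      by rewrite (xu _ pq) E2 eqxx orbT.
    by rewrite (yu _ pq) -E1 eqxx.
  by move=> /(closed_connect cl) <-; rewrite set21.
have iso x y : x \in L -> ~~ connect (del_edge e x (nb x)) x y || (y == x).
  move=> xL; have [_ xu] := nbP x xL.
  case: (boolP (connect _ _ _)) => //= /connectP[[|z p] /= pp ->] //.
  case/andP: pp => xz _; have := xz.
  by rewrite (xu z (del_edge_sub xz)) del_edge_same.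
have sub : cyclic_arcs e :|: (A :|: B) \subset arcs e.
  apply/subsetP => -[x y]; rewrite !inE /= => /orP[/andP[]//|/orP[]/imsetP[z zL [-> ->]]].
    by case: (nbP z zL).
  by rewrite sy; case: (nbP z zL).
have dis : cyclic_arcs e :&: (A :|: B) = set0.
  apply/setP => -[x y]; rewrite !inE /=; apply/negP => /andP[/andP[exy cxy]].
  case/orP=> /imsetP[z zL [Ex Ey]]; subst x y.
    have := iso z (nb z) zL; rewrite cxy /= => /eqP E.
    by rewrite E ir in exy.
  have := iso z (nb z) zL; rewrite (sym_connect_sym (del_edge_sym _ _ sy)).
  rewrite (eq_connect (@del_edgeC _ _ _ _)) cxy /= => /eqP E.
  by rewrite E ir in exy.
have := subset_leq_card sub.
rewrite !cardsU dis dAB cards0 cA cB sum_deg; lia.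
Qed.

(** * Gluing cycles, and even degree sequences *)

Definition add_cycle (T : finType) (e : rel T) (c : seq T) : rel T :=
  fun x y => e x y || ([set x; y] \in cycle_edges c).

Lemma add_cycle_sym (T : finType) (e : rel T) c :
  symmetric e -> symmetric (add_cycle e c).
Proof. by move=> sy x y; rewrite /add_cycle sy setUC. Qed.

Lemma cycle_edges_neq (T : finType) (c : seq T) x y :
  uniq c -> 1 < size c -> [set x; y] \in cycle_edges c -> x != y.
Proof.
move=> Uc sc; rewrite mem_cycle_edges // => /andP[xc /orP[]/eqP->].
  by rewrite eq_sym next_neq.
by rewrite -{1}(next_prev Uc x) next_neq // mem_prev.
Qed.

Lemma add_cycle_irr (T : finType) (e : rel T) c :
  irreflexive e -> uniq c -> 1 < size c -> irreflexive (add_cycle e c).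
Proof.
move=> ir Uc sc x; rewrite /add_cycle ir /=; apply/negP => /(cycle_edges_neq Uc sc).
by rewrite eqxx.
Qed.

Lemma add_cycle_is_cycle (T : finType) (e : rel T) c :
  uniq c -> 2 < size c -> is_cycle (add_cycle e c) c.
Proof.
move=> Uc sc; split=> //; apply: cycle_from_next => // x xc.
by rewrite /add_cycle mem_cycle_edges_next ?orbT.
Qed.

(** Cycles are glued as [v :: p], with [v] the attaching vertex and [p] isolated so far. Only [v]
    lies outside [p], so every new edge has a fresh end. *)
Lemma cycle_edges_cons (T : finType) (v : T) p x y :
  uniq (v :: p) -> 1 < size p -> [set x; y] \in cycle_edges (v :: p) ->
  (x \in p) || (y \in p).
Proof.
move=> Uc sp xyc.
have := cycle_edges_neq Uc (leqW sp) xyc.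
move: xyc; rewrite mem_cycle_edges // => /andP[xc yc].
have {yc}: y \in v :: p by case/orP: yc => /eqP->; rewrite ?mem_next ?mem_prev.
by move: xc; rewrite !inE => /orP[/eqP->|->//] /orP[/eqP->|->]; rewrite ?eqxx ?orbT.
Qed.

Lemma deg_add_cycle (T : finType) (e : rel T) v p x :
  symmetric e -> uniq (v :: p) -> 1 < size p ->
  (forall y z, y \in p -> e y z = false) ->
  deg (add_cycle e (v :: p)) x = deg e x + (x \in v :: p).*2.
Proof.
move=> sy Uc sp iso; set c := v :: p.
have [xc|xc] := boolP (x \in c); last first.
  rewrite addn0; apply: eq_card => y.
  by rewrite !inE /add_cycle mem_cycle_edges // (negPf xc) orbF.
rewrite /deg; have -> : [set y | add_cycle e c x y] =
    [set y | e x y] :|: [set next c x; prev c x].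
  by apply/setP => y; rewrite !inE /add_cycle mem_cycle_edges // xc.
rewrite cardsU cards2 next_neq_prev //.
suff -> : [set y | e x y] :&: [set next c x; prev c x] = set0 by rewrite cards0 subn0.
apply/setP => y; rewrite !inE; apply/negP => /andP[xy yc].
have /(cycle_edges_cons Uc sp) : [set x; y] \in cycle_edges c by rewrite mem_cycle_edges // xc.
by case/orP=> /iso H; [rewrite H in xy | rewrite sy H in xy].
Qed.

(** At a fresh vertex only the two glued edges are available, so [c] takes both. Since [p] is
    connected off [v], [c] visits all of [p] and thus contains every glued edge. *)
Lemma add_cycle_through (T : finType) (e : rel T) v p c :
  symmetric e -> irreflexive e -> uniq (v :: p) -> 1 < size p ->
  (forall y z, y \in p -> e y z = false) ->
  is_cycle (add_cycle e (v :: p)) c -> has [in p] c ->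
  cycle_edges c = cycle_edges (v :: p).
Proof.
move=> sy ir Uv sp iso [Uc sc cc] /hasP[x xc xp].
set C := v :: p; have sa := add_cycle_sym C sy.
have step w : w \in c -> w \in p ->
    [set w; next C w] \in cycle_edges c /\ [set w; prev C w] \in cycle_edges c.
  move=> wc wp.
  have wC z : add_cycle e C w z -> (z == next C w) || (z == prev C w).
    by rewrite /add_cycle iso //= mem_cycle_edges // => /andP[].
  have := wC _ (next_cycle cc wc).
  have := prev_cycle cc wc; rewrite sa => /wC.
  have := next_neq_prev Uc sc wc; rewrite !mem_cycle_edges // wc.
  by move=> n /orP[]/eqP E1 /orP[]/eqP E2; move: n; rewrite E1 E2 ?eqxx ?orbT.
have cC : is_cycle (add_cycle e C) C by apply: add_cycle_is_cycle.
have vC : v \in C by rewrite mem_head.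
pose r := [rel y z | [&& add_cycle e C y z, y != v & z != v]].
have sr : symmetric r by move=> y z /=; rewrite sa [(y != v) && _]andbC.
have pc w : w \in p -> w \in c.
  have nv u : u \in p -> u != v.
    by move=> up; apply: contraTneq up => ->; case/andP: Uv.
  move=> wp; have off := cycle_connect_off cC vC.
  have cxw : connect r x w.
    apply: (@connect_trans _ _ (next C v)).
      by rewrite (sym_connect_sym sr); apply: off; rewrite ?nv // inE xp orbT.
    by apply: off; rewrite ?nv // inE wp orbT.
  pose S := [pred z | (z \in c) && (z \in p)].
  have cl : closed r S.
    apply: intro_closed; first exact: sym_connect_sym.
    move=> y z /= /and3P[yz yv zv] /andP[yc yp].
    move: yz; rewrite /add_cycle iso //= => yzC.
    have zC : z \in C by move: yzC; rewrite setUC mem_cycle_edges // => /andP[].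
    have zp : z \in p by move: zC; rewrite inE (negPf zv).
    rewrite inE /= zp.
    have [h1 h2] := step y yc yp.
    move: yzC; rewrite mem_cycle_edges // andbT => /andP[_ /orP[]/eqP->].
      by move: h1; rewrite setUC mem_cycle_edges // => /andP[].
    by move: h2; rewrite setUC mem_cycle_edges // => /andP[].
  have := closed_connect cl cxw; rewrite !inE xc xp /=.
  by move/esym/andP => [].
apply/esym/cycle_edges_sub_eq => //; apply/subsetP => g /imsetP[w wC ->].
case/orP: (cycle_edges_cons Uv sp (mem_cycle_edges_next wC)) => H.
  by case: (step w (pc _ H) H).
by case: (step _ (pc _ H) H) => _; rewrite prev_next // setUC.
Qed.

Lemma add_cycle_avoid (T : finType) (e : rel T) v p c :
  uniq (v :: p) -> 1 < size p ->
  is_cycle (add_cycle e (v :: p)) c -> ~~ has [in p] c -> is_cycle e c.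
Proof.
move=> Uv sp [Uc sc cc] /hasPn H; split=> //; apply: cycle_from_next => // x xc.
have nc : next c x \in c by rewrite mem_next.
case/orP: (next_cycle cc xc) => // /(cycle_edges_cons Uv sp).
by have := H x xc; have := H _ nc => /= /negPf-> /negPf->.
Qed.

(** A cycle either meets [p], and then has the edges of [v :: p], or is an old one. These kinds
    share no edge, because every edge of the first has an end in [p]. *)
Lemma edge_disjoint_cycles_add_cycle (T : finType) (e : rel T) v p :
  symmetric e -> irreflexive e -> uniq (v :: p) -> 1 < size p ->
  (forall y z, y \in p -> e y z = false) ->
  edge_disjoint_cycles e -> edge_disjoint_cycles (add_cycle e (v :: p)).
Proof.
move=> sy ir Uv sp iso K c1 c2 g cc1 cc2 g1 g2.
have sa := add_cycle_sym (v :: p) sy.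
have thr := add_cycle_through sy ir Uv sp iso.
have trans d1 d2 : is_cycle (add_cycle e (v :: p)) d1 ->
    is_cycle (add_cycle e (v :: p)) d2 -> g \in cycle_edges d1 ->
    g \in cycle_edges d2 -> has [in p] d1 -> has [in p] d2.
  move=> k1 k2 + h2 h1; rewrite (thr _ k1 h1) => h.
  case/imsetP: (h) => x xc E; rewrite E in h h2.
  have [_ x2 y2] := cycle_edge_rel sa k2 h2.
  by case/orP: (cycle_edges_cons Uv sp h) => ?; apply/hasP;
    [exists x | exists (next (v :: p) x)].
have [h1|h1] := boolP (has [in p] c1).
  by rewrite (thr _ cc1 h1) (thr _ cc2 (trans _ _ cc1 cc2 g1 g2 h1)).
have h2 : ~~ has [in p] c2 by apply: contra h1; apply: trans.
exact: K (add_cycle_avoid Uv sp cc1 h1) (add_cycle_avoid Uv sp cc2 h2) g1 g2.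
Qed.

Lemma cyclic_arcs_add_cycle (T : finType) (e : rel T) c :
  symmetric e -> uniq c -> 2 < size c -> cyclic_arcs e = arcs e ->
  cyclic_arcs (add_cycle e c) = arcs (add_cycle e c).
Proof.
move=> sy Uc sc NB; apply/setP => -[x y]; apply/idP/idP; first by rewrite !inE => /andP[].
rewrite inE => /orP[xy|xyc].
  have : (x, y) \in cyclic_arcs e by rewrite NB inE.
  have S : subrel e (add_cycle e c) by move=> ? ?; rewrite /add_cycle => ->.
  rewrite !inE /= => /andP[/S -> cxy] /=.
  exact: connect_mono (del_edge_mono S) _ _ cxy.
exact: cycle_cyclic_arcs (add_cycle_sym _ sy) (add_cycle_is_cycle _ Uc sc) xyc.
Qed.

Definition cactus_with_degrees (T : finType) (d : T -> nat) (e : rel T) : Prop :=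
  [/\ symmetric e, irreflexive e, deg e =1 d,
      forall x y, 0 < d x -> 0 < d y -> connect e x y
    & edge_disjoint_cycles e].

Lemma deg0 (T : finType) (e : rel T) x : deg e x = 0 -> forall y, e x y = false.
Proof.
by move=> d0 y; apply/negP => xy; have /deg_gt0P : exists y, e x y by [exists y]; rewrite d0.
Qed.

(** The last hypothesis covers both uses: laying the first cycle in an edgeless graph, and gluing at
    a vertex already present. *)
Lemma cactus_add_cycle (T : finType) (d d' : T -> nat) (e : rel T) v p :
  cactus_with_degrees d' e -> cyclic_arcs e = arcs e ->
  uniq (v :: p) -> 1 < size p ->
  (forall x, d x = d' x + (x \in v :: p).*2) ->
  (forall x, x \in p -> d' x = 0) ->
  ((forall x, d' x = 0) \/ 0 < d' v) ->
  exists e', cactus_with_degrees d e' /\ cyclic_arcs e' = arcs e'.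
Proof.
move=> [sy ir de cn K] NB Uv sp dd iso dv.
have iso' y z : y \in p -> e y z = false by move=> yp; apply: deg0; rewrite de iso.
exists (add_cycle e (v :: p)); split; last exact: cyclic_arcs_add_cycle.
split.
- exact: add_cycle_sym.
- by apply: add_cycle_irr => //; apply: leqW.
- by move=> x; rewrite deg_add_cycle // de dd.
- suff H x : 0 < d x -> connect (add_cycle e (v :: p)) v x.
    move=> x y /H vx /H; apply: connect_trans.
    by rewrite (sym_connect_sym (add_cycle_sym _ sy)).
  rewrite dd; have [xc _|xc] := boolP (x \in v :: p).
    have [_ _ cc] := add_cycle_is_cycle e Uv (sp : 2 < size (v :: p)).
    by apply: connect_cycle cc _ _ _ _; rewrite ?mem_head.
  rewrite addn0 => dx; case: dv => [H|dv]; first by rewrite H in dx.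
  by apply: connect_mono (cn _ _ dv dx) => ? ?; rewrite /add_cycle => ->.
- exact: edge_disjoint_cycles_add_cycle.
Qed.

Lemma exists_even_cactus (T : finType) (d : T -> nat) :
  (forall x, ~~ odd (d x)) -> \sum_x d x + 3 <= 3 * #|[set x | 0 < d x]| ->
  exists e, cactus_with_degrees d e /\ cyclic_arcs e = arcs e.
Proof.
elim: {d}_.+1 {-2}d (ltnSn (\sum_x d x)) => // k IH d.
rewrite ltnS => dk ev dn.
have n1 : 2 * #|[set x | 0 < d x]| <= \sum_x d x.
  rewrite card_set_sum big_distrr /=.
  by apply: leq_sum => x _; have := ev x; case: (d x) => [|[|]] //= i; lia.
have [/existsP[v dv]|] := boolP [exists v, 3 < d v]; last first.
  (* All positive degrees equal 2: one cycle runs through the support in any order. [n1] and the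
     bound [dn] give at least three vertices. *)
  rewrite negb_exists => /forallP d2.
  have {d2}d2 x : d x = (0 < d x).*2.
    by have := ev x; have := d2 x; case: (d x) => [|[|[|[|]]]].
  have sE : size (enum [set x | 0 < d x]) = #|[set x | 0 < d x]| by rewrite cardE.
  case Es : (enum [set x | 0 < d x]) sE => [|v p] /= sE; first lia.
  have sp : 1 < size p by lia.
  have mem x : (x \in v :: p) = (0 < d x) by rewrite -Es mem_enum inE.
  apply: (@cactus_add_cycle _ d (fun=> 0) (fun _ _ => false) v p) => //.
  - split=> //.
      move=> x; apply/eqP; rewrite cards_eq0; apply/eqP/setP => y.
      by rewrite !inE.
    move=> c1 c2 g [_ s1 cc1]; case: c1 s1 cc1 => // x q _ /= .
    by case: q.
  - by apply/setP => p'; rewrite !inE.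
  - by rewrite -Es enum_uniq.
  - by move=> x; rewrite mem add0n -d2.
  - by left.
(* Positive even degrees other than 2 are at least 4; a sum below three times the support then
   forces two vertices of degree 2, the free corners of a triangle at [v]. *)
have n2 : 4 * #|[set x | 0 < d x]| <= \sum_x d x + 2 * #|[set x | d x == 2]|.
  rewrite !card_set_sum !big_distrr -big_split /=.
  by apply: leq_sum => x _; have := ev x; case: (d x) => [|[|[|[|]]]] //= i; lia.
have /card_gt1P[x [y []]] : 1 < #|[set x | d x == 2]| by lia.
rewrite !inE => /eqP dx /eqP dy xy.
have xv : x != v by apply: contraTneq dv => <-; rewrite dx.
have yv : y != v by apply: contraTneq dv => <-; rewrite dy.
(* Taking off the triangle lowers the sum by 6 and the support by 2, which keeps the bound. *)
pose d' z := d z - (z \in [:: v; x; y]).*2.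
have dd z : d z = d' z + (z \in [:: v; x; y]).*2.
  rewrite /d' !inE; have [->|_] := eqVneq z v; first by rewrite /=; lia.
  have [->|_] := eqVneq z x; first by rewrite dx.
  by have [->|_] := eqVneq z y; rewrite ?dy //= subn0 addn0.
have dx' : d' x = 0 by rewrite /d' !inE eqxx orbT dx.
have dy' : d' y = 0 by rewrite /d' !inE eqxx !orbT dy.
have dv' : d' v = d v - 2 by rewrite /d' mem_head.
have Uc : uniq [:: v; x; y] by rewrite /= !inE negb_or eq_sym xv eq_sym yv xy.
have sumE : \sum_z d z = \sum_z d' z + 6.
  rewrite (eq_bigr _ (fun z _ => dd z)) big_split /=; congr (_ + _).
  under eq_bigr do rewrite -mul2n.
  rewrite -big_distrr /= -card_set_sum.
  have -> : [set i in [:: v; x; y]] = [set:: [:: v; x; y]] by [].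
  by rewrite cardsE (card_uniqP Uc).
have suppE : #|[set z | 0 < d z]| = #|[set z | 0 < d' z]| + 2.
  have -> : [set z | 0 < d' z] = [set z | 0 < d z] :\: [set x; y].
    apply/setP => z; rewrite !inE negb_or.
    have [->|zx] := eqVneq z x; first by rewrite dx'.
    have [->|zy] := eqVneq z y; first by rewrite dy'.
    rewrite /d' !inE (negPf zx) (negPf zy) !orbF.
    by case: eqVneq => [->|]; rewrite /= ?subn0 //; lia.
  have S : [set x; y] \subset [set z | 0 < d z].
    by apply/subsetP => z /set2P[]->; rewrite inE ?dx ?dy.
  have := subset_leq_card S.
  by rewrite cardsD (setIidPr S) cards2 xy; lia.
have [|||e [Ke NB]] := IH d'; try lia.
  move=> z; have := ev z; rewrite dd oddD odd_double addbF //.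
apply: (cactus_add_cycle Ke NB Uc) => //; last by right; rewrite dv'; lia.
by move=> z; rewrite !inE => /orP[]/eqP->.
Qed.

(** * Attaching leaves *)

Lemma leaf_notin_cycle (T : finType) (r : rel T) x v c :
  symmetric r -> (forall z, r x z -> z = v) -> is_cycle r c -> x \notin c.
Proof.
move=> sr rx [Uc sc cc]; apply/negP => xc.
have /negP[] := next_neq_prev Uc sc xc.
have := prev_cycle cc xc; rewrite sr => /rx->.
by rewrite (rx _ (next_cycle cc xc)).
Qed.

Lemma cycle_off (T : finType) (r r' : rel T) x c :
  (forall z w, z != x -> w != x -> r z w -> r' z w) ->
  is_cycle r c -> x \notin c -> is_cycle r' c.
Proof.
move=> rr' [Uc sc cc] xc; split=> //; apply: cycle_from_next => // z zc.
have nx w : w \in c -> w != x by move=> wc; apply: contraNneq xc => <-.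
by apply: rr'; rewrite ?nx ?mem_next //; apply: next_cycle.
Qed.

(** The new edge [xv] creates no cycle. As a bridge it has the bare vertex [x] on one side; any
    other bridge of the new graph is a bridge of the old one, with the same cycles on its sides. *)
Lemma cactus_add_leaf (T : finType) (d d' : T -> nat) (e : rel T) x v :
  cactus_with_degrees d' e -> core_bridgeless e -> x != v ->
  d' x = 0 -> d x = 1 -> 0 < d' v -> d v = (d' v).+1 ->
  (forall z, z != x -> z != v -> d' z = d z) ->
  exists e', cactus_with_degrees d e' /\ core_bridgeless e'.
Proof.
move=> [sy ir de cn K] N xv dx' dx dv' dv dd.
pose e' y z := e y z || ([set y; z] == [set x; v]).
have iso z : e x z = false by apply: deg0; rewrite de.
have ee' : subrel e e' by move=> y z; rewrite /e' => ->.
have sy' : symmetric e' by move=> y z; rewrite /e' sy setUC.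
have xv' : e' x v by rewrite /e' eqxx orbT.
have xu z : e' x z -> z = v.
  by rewrite /e' iso => /eqP/set2_inj[[]|[E _]] //; rewrite E eqxx in xv.
have off y z : y != x -> z != x -> e' y z -> e y z.
  move=> yx zx /orP[] // /eqP/set2_inj[[E _]|[_ E]]; by rewrite E eqxx in yx zx.
(* Deleting the new edge gives back [e], so the degree lemmas for [del_edge] can be read
   backwards. *)
have del y z : del_edge e' x v y z = e y z.
  rewrite /del_edge /e'; case: eqP => [E|_]; rewrite ?orbF ?andbT ?andbF //.
  by case: (set2_inj E) => -[-> ->]; rewrite ?[e v x]sy iso.
have degE z : deg (del_edge e' x v) z = d' z.
  by rewrite -de; apply: eq_card => y; rewrite !inE del.
have nocyc c : is_cycle e' c -> is_cycle e c.
  by move=> cc; apply: cycle_off off cc (leaf_notin_cycle sy' xu cc).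
exists e'; split; first split=> //.
- move=> y; rewrite /e' ir; apply/eqP => /set2_inj[[E1 E2]|[E1 E2]];
  by move: xv; rewrite -E1 -E2 eqxx.
- move=> z; have [->|zx] := eqVneq z x.
    by rewrite (deg_del_edgel xv') degE dx' dx.
  have [->|zv] := eqVneq z v; last by rewrite -dd // -degE deg_del_edge_neq.
  rewrite (@deg_del_edgel _ e' v x) 1?sy' // dv -degE; congr _.+1.
  by apply: eq_card => y; rewrite !inE del_edgeC.
- suff H z : 0 < d z -> connect e' v z.
    move=> y z /H vy /H; apply: connect_trans.
    by rewrite (sym_connect_sym sy').
  have [-> _|zx] := eqVneq z x; first by rewrite connect1 // sy'.
  have [-> _|zv] := eqVneq z v; first exact: connect0.
  by rewrite -dd // => dz; apply: connect_mono ee' _ _ (cn _ _ dv' dz).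
- by move=> c1 c2 g /nocyc cc1 /nocyc; apply: K.
move=> a b ab nab ca cb.
have side y w : [set y; w] = [set a; b] -> y = x -> ~ comp_has_cycle (del_edge e' a b) y.
  move=> E Ex [c [[Uc sc cc] /allP ca']].
  have H z : z \in c -> z = x.
    move=> /ca' /connectP[[|u p] /=]; first by rewrite Ex.
    case/andP=> + _; rewrite Ex /del_edge => /andP[xu'].
    rewrite (xu _ xu') -E Ex.
    suff -> : w = v by rewrite eqxx.
    by apply: xu; rewrite -Ex; case: (set2_inj E) => -[-> ->] //; rewrite sy'.
  case: c sc Uc H {cc ca'} => [|p [|q c]] // _ /= /andP[+ _] H.
  have -> : p = q by rewrite [LHS]H ?[RHS]H // !inE eqxx ?orbT.
  by rewrite mem_head.
have ax : a != x by apply/eqP => E; apply: (side a b).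
have bx : b != x by apply/eqP => E; apply: (side b a); rewrite // setUC.
have doff y z : y != x -> z != x -> del_edge e' a b y z -> del_edge e a b y z.
  by move=> yx zx /andP[/(off _ _ yx zx)]; rewrite /del_edge => -> ->.
have dxu z : del_edge e' a b x z -> z = v by move=> /del_edge_sub /xu.
have dsy := del_edge_sym a b sy'.
have tr y : y != x -> comp_has_cycle (del_edge e' a b) y -> comp_has_cycle (del_edge e a b) y.
  move=> yx [c [cc /allP cy]]; have xc := leaf_notin_cycle dsy dxu cc.
  exists c; split; first exact: cycle_off doff cc xc.
  apply/allP => z zc; have zx : z != x by apply: contraNneq xc => <-.
  exact: connect_retract_leaf dsy dxu doff yx zx (cy z zc).
apply: (N a b (off _ _ ax bx ab)); try exact: tr.
by apply: contra nab; apply/connect_mono/del_edge_mono.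
Qed.

Lemma core_bridgeless_cyclic (T : finType) (e : rel T) :
  cyclic_arcs e = arcs e -> core_bridgeless e.
Proof.
move=> NB u v uv; have : (u, v) \in arcs e by rewrite inE.
by rewrite -NB !inE => /andP[_ /= ->].
Qed.

(** Removing a leaf and lowering a degree above 2 changes the sum, the support and the number of
    ones by 2, 1 and 1, so both inequalities on the sum persist. *)
Lemma exists_core_cactus (T : finType) (d : T -> nat) :
  ~~ odd (\sum_x d x) -> 2 * #|[set x | 0 < d x]| <= \sum_x d x ->
  #|[set x | odd (d x) && (1 < d x)]| <= #|[set x | d x == 1]| ->
  \sum_x d x + #|[set x | d x == 1]| + 3 <= 3 * #|[set x | 0 < d x]| ->
  exists e, cactus_with_degrees d e /\ core_bridgeless e.
Proof.
elim: {d}_.+1 {-2}d (ltnSn (\sum_x d x)) => // k IH d.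
rewrite ltnS => dk ev dn o1 bnd.
(* When no odd degree above 1 is left, lowering an even one creates one. By parity the number of
   ones is then even, hence at least 2, and [o1] survives. *)
have par : odd (\sum_x d x) =
    odd (#|[set x | odd (d x) && (1 < d x)]| + #|[set x | d x == 1]|).
  rewrite !card_set_sum -big_split /=.
  apply: (big_ind2 (fun a b => odd a = odd b)) => // [a b a' b' h h'|x _].
    by rewrite !oddD h h'.
  by case: (d x) => [|[|i]] //=; case: (odd i).
have [L0|/set0Pn[x]] := eqVneq [set x | d x == 1] set0.
  rewrite L0 cards0 leqn0 cards_eq0 in o1 bnd.
  have [||e [Ke NB]] := @exists_even_cactus T d; last first.
  - by exists e; split=> //; apply: core_bridgeless_cyclic.
  - by rewrite addn0 in bnd.
  move=> x; apply/negP => dx.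
  have : x \in [set x | d x == 1] = false by rewrite L0 inE.
  have : x \in [set x | odd (d x) && (1 < d x)] = false by rewrite (eqP o1) inE.
  by rewrite !inE dx; case: (d x) dx => [|[|]].
rewrite inE => /eqP dx.
(* [2 < d v] ensures that [v] becomes neither a leaf nor absent. Such a [v] exists: with all degrees
   at most 2, the leaf [x] would push the sum below twice the support. *)
have [v [dv ov]] : exists v, 2 < d v /\
    (odd (d v) || (#|[set x | odd (d x) && (1 < d x)]| == 0)).
  have [O0|/set0Pn[v]] := eqVneq [set x | odd (d x) && (1 < d x)] set0; last first.
    rewrite inE => /andP[ov dv]; exists v; split; last by rewrite ov.
    by case: (d v) ov dv => [|[|[|]]].
  rewrite O0 cards0 eqxx.
  have [/existsP[v dv]|] := boolP [exists v, 2 < d v]; first by exists v; rewrite orbT.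
  rewrite negb_exists => /forallP d2.
  suff : \sum_x d x < 2 * #|[set x | 0 < d x]| by rewrite ltnNge dn.
  rewrite card_set_sum big_distrr /= (bigD1 x) //= [X in _ < X](bigD1 x) //= dx.
  rewrite -addSn; apply: leq_add => //; apply: leq_sum => z _.
  by have := d2 z; case: (d z) => [|[|[|]]].
have xv : x != v by apply: contraTneq dv => <-; rewrite dx.
pose d' z := d z - (z \in [set x; v]).
have H z : z != x -> z != v -> d' z = d z.
  by move=> zx zv; rewrite /d' !inE (negPf zx) (negPf zv) subn0.
have dx' : d' x = 0 by rewrite /d' set21 dx.
have dv' : d v = (d' v).+1 by rewrite /d' set22; lia.
have h1 := card_update2 (fun k => odd k && (1 < k)) xv H.
have h2 := card_update2 (fun k => k == 1) xv H.
have h3 := sum_update2 id xv H.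
have h4 := card_update2 (fun k => 0 < k) xv H.
move: h1 h2 h3 h4; rewrite /= dx dx' dv' /=.
have g1 : 1 < d' v by lia.
have g2 : (d' v == 1) = false by lia.
have g3 : ((d' v).+1 == 1) = false by lia.
rewrite g1 g2 g3 (ltnW g1) ltnS (ltnW g1) !andbT !addn0 add0n => h1 h2 h3 h4.
rewrite dv' /= in ov.
have [|||||e [Ke NB]] := IH d'; last first.
- by apply: cactus_add_leaf Ke NB xv dx' dx _ dv' H; apply: ltnW.
- lia.
- lia.
- lia.
- lia.
- lia.
Qed.

(** * The equivalence *)

Lemma cactus_edge_disjoint_cycles (T : finType) (e : rel T) :
  symmetric e -> cactus e -> edge_disjoint_cycles e.
Proof.
move=> sy [_ K] c1 c2 g cc1 cc2 g1 g2.
case/imsetP: (g1) => x _ E; rewrite E in g1 g2.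
by have [xy _ _] := cycle_edge_rel sy cc1 g1; apply: (K _ _ xy).
Qed.

(** If the ends of a deleted edge stay connected, every path can be rerouted around it; so a
    disconnecting edge separates its own ends. *)
Lemma core_cactus_of_edge_disjoint_cycles (T : finType) (e : rel T) :
  symmetric e -> connected_graph e -> edge_disjoint_cycles e ->
  core_bridgeless e -> core_cactus e.
Proof.
move=> sy C K N; split; first by split=> // u v _ c1 c2; apply: K.
move=> [u [v [[uv nC] cu cv]]]; apply: (N u v uv) => //; apply/negP => cuv.
apply: nC => x y; apply: connect_sub (C x y) => p q pq.
have [E|n] := eqVneq [set p; q] [set u; v]; last by apply: connect1; rewrite /del_edge pq.
case: (set2_inj E) => -[-> ->] //.
by rewrite (sym_connect_sym (del_edge_sym _ _ sy)).
Qed.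

Theorem theorem6p2 (n : nat) (d : 'I_n -> nat) :
  degree_sequence d -> 3 <= n -> 2 * n < \sum_(i < n) d i ->
  let m := (\sum_(i < n) d i) %/ 2 in
  (exists e : rel 'I_n, realizes d e /\ core_cactus e) <->
  (muodd d <= mu1 d /\ m <= (3 * (n - 1) - mu1 d) %/ 2).
Proof.
move=> [dpos dev _] n3 dn m.
have cT : #|'I_n| = n by rewrite card_ord.
split=> [[e [[[sy ir] de] [Kc N]]]|[o1 bnd]].
  have K := cactus_edge_disjoint_cycles sy Kc.
  have CB : core_bridgeless e.
    move=> u v uv nuv cu cv; apply: N; exists u, v; split=> //; split=> // C.
    by rewrite C in nuv.
  have L : #|[set x | deg e x == 1]| = mu1 d.
    by apply: eq_card => x; rewrite !inE de.
  have O : #|[set x | odd (deg e x) && (1 < deg e x)]| = muodd d.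
    by apply: eq_card => x; rewrite !inE de.
  have S : \sum_x deg e x = \sum_(i < n) d i by apply: eq_bigr => i _; rewrite de.
  split; first by rewrite -L -O card_odd_deg_le_leaves.
  (* Eliminating the number of cyclic arcs from [h1] and [h2] leaves
     [2 * m + mu1 d <= 3 * (n - 1)]. *)
  have h1 : 3 * \sum_x deg e x + 6 <= 6 * #|'I_n| + #|cyclic_arcs e|.
    by apply: edge_disjoint_cycles_sum_deg; rewrite ?cT //; lia.
  have h2 : #|cyclic_arcs e| + 2 * #|[set x | deg e x == 1]| <= \sum_x deg e x.
    by apply: leaves_cyclic_arcs => //; [case: Kc | rewrite cT].
  rewrite cT L S in h1 h2; rewrite /m.
  by move: h1 h2; move: (\sum_(i < n) d i) #|_| (mu1 d) => ? ? ?; lia.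
have supp : #|[set x | 0 < d x]| = n.
  rewrite -[RHS]cT -cardsT; apply: eq_card => x; rewrite !inE.
  by case/andP: (dpos x).
have [||||e [[sy ir de cn K] CB]] := @exists_core_cactus _ d; rewrite ?supp //.
- exact: ltnW.
(* By [dn], [m] is positive, so the difference under the floor is not truncated to 0; evenness of
   the sum turns [m] back into half of it. *)
- move: bnd dev; rewrite /m /mu1.
  by move: (\sum_(i < n) d i) dn #|_| => ? ? ?; lia.
exists e; split; first by split.
apply: core_cactus_of_edge_disjoint_cycles => // x y.
by apply: cn; [case/andP: (dpos x) | case/andP: (dpos y)].
Qed.
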